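(* Let $k$ be a positive integer. Then the function $\Phi_k$ is multiplicative (i.e. $\Phi_k(mn)=\Phi_k(m)\Phi_k(n)$ whenever $\gcd(m,n)=1$), and for every positive integer $n$, \[ \Phi_k(n)=\begin{cases} n^{k-1} \varphi(n), & \text{if $k$ is odd}; \\[4pt] n^{k-1} \varphi(n) \displaystyle \prod_{\substack{p \mid n\\ p>2}} \left(1-\frac {(-1)^{k(p-1)/4}}{p^{k/2}}\right), & \text{if $k$ is even}, \end{cases} \] where the product runs over the odd primes $p$ dividing $n$.
   Context: For positive integers $k,n$, $\Phi_k(n)$ denotes the number of $k$-tuples $(x_1,\ldots,x_k)\in(\mathbb{Z}/n\mathbb{Z})^k$ such that $\gcd(x_1^2+\cdots+x_k^2,n)=1$. $\varphi$ is Euler's totient function. *)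

(* Defs.v *)
From mathcomp Require Import all_boot all_order all_algebra.

Set Implicit Arguments.
Unset Strict Implicit.
Unset Printing Implicit Defensive.

(* Z/nZ is represented by the least residues 'I_n, for every n >= 1 including
   n = 1 (where 'Z_n would denote Z/2Z). The gcd of n with an integer depends
   only on the class of that integer mod n, so it may be computed on the
   representatives. *)
Definition Phi (k n : nat) : nat :=
  #|[set x : {ffun 'I_k -> 'I_n} | gcdn (\sum_(i < k) x i ^ 2) n == 1]|.

(* Main.v *)
Require Import Defs.
From mathcomp Require Import all_boot all_order all_algebra all_field.
From mathcomp Require Import zify ring.

(** Multiplicativity is the Chinese remainder theorem, and reduction mod p gives
    Phi_k(p^(a+1)) = p^(k a) Phi_k(p), so only the number N_k of zeros of
    x_1^2 + ... + x_k^2 over F_p, p odd, is needed. Write eta = (-1)^((p-1)/2).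
    The equation a^2 + b^2 = c has 1 + (p-1)(1 + eta) solutions for c = 0. Since
    every c is a sum of two squares, composition of the norm form makes the number
    of solutions independent of c <> 0, so it is p - eta by counting all pairs.
    Splitting off two variables, N_(k+2) = p^k (p - eta) + p eta N_k, which is
    solved from N_0 = N_1 = 1. *)

Set Implicit Arguments.
Unset Strict Implicit.
Unset Printing Implicit Defensive.

(** * Multiplicativity and reduction from prime powers to primes *)

(** Equal cardinalities make the entrywise use of [g] a bijection. It serves twice: for the Chinese
    remainder map and for Euclidean division by p. *)
Lemma card_ffun_pred_pair (I A B C : finType) (g : A -> B * C)
    (P : pred {ffun I -> A}) (Q : pred {ffun I -> B}) (R : pred {ffun I -> C}) :
    injective g -> #|A| = #|B| * #|C| ->
    (forall x, P x = Q [ffun i => (g (x i)).1] && R [ffun i => (g (x i)).2]) ->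
  #|[set x | P x]| = #|[set y | Q y]| * #|[set z | R z]|.
Proof.
move=> g_inj cardA PE.
pose h (x : {ffun I -> A}) : {ffun I -> B} * {ffun I -> C} :=
  ([ffun i => (g (x i)).1], [ffun i => (g (x i)).2]).
have h_inj : injective h.
  move=> x y [/ffunP e1 /ffunP e2]; apply/ffunP=> i; apply: g_inj.
  by move: (e1 i) (e2 i); rewrite !ffunE; case: (g (x i)) (g (y i)) => ? ? [? ?] /= -> ->.
have h_bij : bijective h.
  by apply: inj_card_bij => //; rewrite card_prod !card_ffun cardA expnMn.
rewrite -cardsX -(on_card_preimset (f := h)); last exact: onW_bij.
by apply: eq_card => x; rewrite !inE PE.
Qed.

Lemma modn_sum_sqr (k n : nat) (f g : 'I_k -> nat) :
  (forall i, f i = g i %[mod n]) ->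
  \sum_i f i ^ 2 = \sum_i g i ^ 2 %[mod n].
Proof.
move=> fg; rewrite -modn_summ -[RHS]modn_summ; congr (_ %% _).
by apply: eq_bigr => i _; rewrite -modnXm fg modnXm.
Qed.

Lemma coprime_sum_sqr_mod (k n : nat) (f g : 'I_k -> nat) :
  (forall i, f i = g i %[mod n]) ->
  coprime (\sum_i f i ^ 2) n = coprime (\sum_i g i ^ 2) n.
Proof. by move=> fg; rewrite -coprime_modl (modn_sum_sqr fg) coprime_modl. Qed.

Lemma Phi_coprimeM (k m n : nat) :
  0 < m -> 0 < n -> coprime m n -> Phi k (m * n) = Phi k m * Phi k n.
Proof.
case: m n => [//|m] [//|n] _ _ co_mn.
pose g (a : 'I_(m.+1 * n.+1)) : 'I_m.+1 * 'I_n.+1 := (inord (a %% m.+1), inord (a %% n.+1)).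
rewrite /Phi; apply: (card_ffun_pred_pair (g := g)).
- move=> a b [] /(congr1 val) /=; rewrite !inordK ?ltn_pmod // => e1.
  move/(congr1 val) => /=; rewrite !inordK ?ltn_pmod // => e2; apply: val_inj => /=.
  by rewrite -(modn_small (ltn_ord a)) -(modn_small (ltn_ord b))
    (chinese_mod co_mn a) (chinese_mod co_mn b) e1 e2.
- by rewrite !card_ord.
move=> x; rewrite -!/(coprime _ _) coprimeMr.
by congr (_ && _); apply: coprime_sum_sqr_mod => i;
  rewrite ffunE /= inordK ?ltn_pmod // modn_mod.
Qed.

(** Division by p splits each entry into a remainder, which alone decides coprimality to p, and a
    quotient, which is free. *)
Lemma Phi_primeX (k p a : nat) :
  prime p -> Phi k (p ^ a.+1) = Phi k p * (p ^ a) ^ k.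
Proof.
move=> p_pr; have p_gt0 := prime_gt0 p_pr.
have pa_gt0 : 0 < p ^ a by rewrite expn_gt0 p_gt0.
have mod_lt (x : 'I_(p ^ a.+1)) : x %% p < p by rewrite ltn_pmod.
have div_lt (x : 'I_(p ^ a.+1)) : x %/ p < p ^ a by rewrite ltn_divLR // -expnSr.
pose g x : 'I_p * 'I_(p ^ a) := (Ordinal (mod_lt x), Ordinal (div_lt x)).
(* The free quotients are counted through the always true predicate, to fit the shape of
   [card_ffun_pred_pair]. *)
have -> : (p ^ a) ^ k = #|[set z : {ffun 'I_k -> 'I_(p ^ a)} | predT z]|.
  by rewrite -[in LHS](card_ord (p ^ a)) -[k in LHS]card_ord -card_ffun cardsE.
rewrite /Phi; apply: (card_ffun_pred_pair (g := g)).
- move=> x y [e1 e2]; apply: val_inj => /=.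
  by rewrite (divn_eq x p) (divn_eq y p) e1 e2.
- by rewrite !card_ord expnS.
move=> x; rewrite andbT -!/(coprime _ _) coprime_pexpr //.
by apply: coprime_sum_sqr_mod => i; rewrite ffunE /= modn_mod.
Qed.

(** * Summation over tuples, one entry at a time *)

Definition ffun_cons (k : nat) (T : finType) (a : T) (y : {ffun 'I_k -> T}) :
    {ffun 'I_k.+1 -> T} :=
  [ffun i => if unlift ord0 i is Some j then y j else a].

Lemma sum_ffunS (k : nat) (T : finType) (G : {ffun 'I_k.+1 -> T} -> nat) :
  \sum_x G x = \sum_(y : {ffun 'I_k -> T}) \sum_a G (ffun_cons a y).
Proof.
pose h (u : {ffun 'I_k -> T} * T) := ffun_cons u.2 u.1.
have h_bij : bijective h.
  exists (fun x : {ffun 'I_k.+1 -> T} => ([ffun j => x (lift ord0 j)], x ord0)) => [[y a]|x].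
    congr (_, _); last by rewrite ffunE unlift_none.
    by apply/ffunP=> j; rewrite !ffunE liftK.
  by apply/ffunP=> i; rewrite !ffunE; case: unliftP => [j ->|->]; rewrite ?ffunE.
by rewrite pair_bigA (reindex h) //; apply: onW_bij.
Qed.

Lemma card_set_sum (T : finType) (P : pred T) : #|[set x | P x]| = \sum_x P x.
Proof. by rewrite -sum1dep_card big_mkcond; apply: eq_bigr => x _; case: (P x). Qed.

Import GRing.Theory Num.Theory.
Local Open Scope ring_scope.

Lemma sum_sqr_ffun_cons (k : nat) (R : finNzRingType) (a : R) (y : {ffun 'I_k -> R}) :
  \sum_i ffun_cons a y i ^+ 2 = a ^+ 2 + \sum_i y i ^+ 2.
Proof.
rewrite big_ord_recl ffunE unlift_none; congr (_ + _).
by apply: eq_bigr => j _; rewrite ffunE liftK.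
Qed.

Lemma expf_card_pred (F : finFieldType) (x : F) : x != 0 -> x ^+ #|F|.-1 = 1.
Proof.
move=> nzx; apply: (mulfI nzx); rewrite mulr1 -exprS prednK ?expf_card //.
by apply/card_gt0P; exists x.
Qed.

(** * Sums of two squares in a finite field of odd order q *)

Section OddFiniteField.

Variable F : finFieldType.
Hypothesis oddF : odd #|F|.

(** As q is odd, [#|F|./2] is (q-1)/2, so [eta] is the quadratic character at -1. *)
Local Notation eta := ((-1) ^+ #|F|./2 : rat).

Lemma odd_card_natr2_neq0 : (2%:R : F) != 0.
Proof.
apply/negP=> /eqP two0.
have two_char : 2 \in [pchar F] by rewrite inE /= two0 eqxx.
have [n cF] : exists n, #|F| = (2 ^ n)%N by eexists; apply: (card_pprimeChar two_char).
by have := finNzRing_gt1 F; move: oddF; rewrite cF oddX orbF => /eqP ->.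
Qed.

Let nz2 := odd_card_natr2_neq0.

Let card_predE : #|F|.-1 = #|F|./2.*2.
Proof. by rewrite -{1}(odd_double_half #|F|) oddF. Qed.

Let card_half_gt0 : (0 < #|F|./2)%N.
Proof. by rewrite half_gt0 finNzRing_gt1. Qed.

Lemma neq_opp (c : F) : c != 0 -> c != - c.
Proof. by move=> nzc; rewrite -subr_eq0 opprK -mulr2n -mulr_natl mulf_neq0. Qed.

Lemma card_sqr_eq (c : F) : c != 0 -> #|[set a : F | a ^+ 2 == c ^+ 2]| = 2.
Proof.
move=> nzc; have -> : [set a : F | a ^+ 2 == c ^+ 2] = [set c; - c].
  by apply/setP=> a; rewrite !inE eqf_sqr.
by rewrite cards2 neq_opp.
Qed.

(** With h = (q-1)/2, X^h - 1 has at most h < q-1 roots, so some nonzero x has x^h != 1. Since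
    x^(2h) = 1, x^h = -1, and x^(h/2) is the required root. *)
Lemma exists_sqrtN1 : ~~ odd #|F|./2 -> exists i : F, i ^+ 2 = -1.
Proof.
move=> even_half; set h := #|F|./2 in even_half.
have [x nzx xh] : exists2 x : F, x != 0 & x ^+ h != 1.
  apply/exists_inP; rewrite -negb_forall_in; apply/negP=> /forall_inP all1.
  have := @max_poly_roots F ('X^h - 1) [seq x <- enum F | x != 0].
  rewrite -size_poly_eq0 size_XnsubC // => /(_ isT).
  have -> : all (root ('X^h - 1)) [seq x <- enum F | x != 0].
    apply/allP=> x; rewrite mem_filter => /andP[nzx _].
    by rewrite rootE !hornerE subr_eq0; apply: all1.
  rewrite filter_uniq ?enum_uniq // => /(_ isT isT).
  have -> : size [seq x <- enum F | x != 0] = #|F|.-1.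
    by rewrite size_filter -sum1_count big_enum_cond /= sum1_card cardC1.
  by rewrite card_predE -/h; move: card_half_gt0; rewrite -/h; lia.
have := expf_card_pred nzx; rewrite card_predE -/h -muln2 exprM => /eqP.
rewrite sqrf_eq1 (negPf xh) /= => /eqP xhN1.
exists (x ^+ h./2); rewrite -exprM muln2 -xhN1; congr (_ ^+ _).
by rewrite -[RHS]odd_double_half (negPf even_half).
Qed.

(** Otherwise 1 = i^(q-1) = (-1)^((q-1)/2) = -1. *)
Lemma sqr_neqN1 (i : F) : odd #|F|./2 -> i ^+ 2 != -1.
Proof.
move=> odd_half; apply/eqP=> iN1.
have nzi : i != 0.
  by apply/eqP=> i0; move/eqP: iN1; rewrite i0 expr0n eq_sym oppr_eq0 oner_eq0.
have := expf_card_pred nzi; rewrite card_predE -mul2n exprM iN1 -signr_odd odd_half.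
by move/eqP; rewrite expr1 eq_sym (negPf (neq_opp (oner_neq0 _))).
Qed.

(** Squaring has fibres of at most two elements, and equality is excluded because q is odd. *)
Lemma card_sqr_half : (#|F| < (#|[set a ^+ 2 | a : F]|).*2)%N.
Proof.
set A := [set a ^+ 2 | a : F].
suff: (#|F| <= #|A|.*2)%N.
  by rewrite leq_eqVlt => /predU1P[cF|//]; move: oddF; rewrite cF odd_double.
rewrite -(sum1_card F) (partition_big (fun a : F => a ^+ 2) (mem A)) /=; last first.
  by move=> a _; apply: imset_f.
have -> : #|A|.*2 = (\sum_(c in A) 2)%N by rewrite sum_nat_const muln2.
apply: leq_sum => c /imsetP[b _ ->].
rewrite sum1dep_card; have [->|nzb] := eqVneq b 0; last by rewrite card_sqr_eq.
apply: (@leq_trans #|[set 0 : F]|); last by rewrite cards1.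
by apply/subset_leq_card/subsetP=> a; rewrite !inE expr0n sqrf_eq0.
Qed.

(** Pigeonhole: the sets of all a^2 and of all c - b^2 each fill more than half of [F], so they
    meet. *)
Lemma exists_sum2_sqr (c : F) : exists a b : F, a ^+ 2 + b ^+ 2 = c.
Proof.
pose A := [set a ^+ 2 | a : F]; pose B := [set c - x | x in A].
have cardB : #|B| = #|A| by rewrite card_imset // => x y /addrI /oppr_inj.
have [/pred0Pn[x /andP[/imsetP[a _ ->] /imsetP[y /imsetP[b _ ->] e]]]|] :=
    boolP (~~ [disjoint A & B]).
  by exists a, b; rewrite e subrK.
rewrite negbK => dAB; have := max_card (mem (A :|: B)).
by rewrite cardsU (disjoint_setI0 dAB) cards0 subn0 cardB addnn leqNgt card_sqr_half.
Qed.

Definition num_sum2_sqr (c : F) := #|[set u : F * F | u.1 ^+ 2 + u.2 ^+ 2 == c]|.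

(* Multiplication by a + b i maps the circle of norm 1 onto that of norm
   a^2 + b^2. *)
Lemma num_sum2_sqr_neq0 (c : F) : c != 0 -> num_sum2_sqr c = num_sum2_sqr 1.
Proof.
have [a [b <-]] := exists_sum2_sqr c => nzc.
pose h (u : F * F) := (a * u.1 - b * u.2, b * u.1 + a * u.2).
have h_bij : bijective h.
  exists (fun u : F * F => ((a * u.1 + b * u.2) / (a ^+ 2 + b ^+ 2),
                   (a * u.2 - b * u.1) / (a ^+ 2 + b ^+ 2))) => -[x y];
  by rewrite /h /=; congr (_, _); field.
rewrite /num_sum2_sqr -(on_card_preimset (f := h)); last exact: onW_bij.
apply: eq_card => -[x y]; rewrite !inE /=.
have -> : (a * x - b * y) ^+ 2 + (b * x + a * y) ^+ 2 = (a ^+ 2 + b ^+ 2) * (x ^+ 2 + y ^+ 2).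
  by ring.
by rewrite -{2}[a ^+ 2 + b ^+ 2]mulr1 (inj_eq (mulfI nzc)).
Qed.

(** If a = 0 then b = 0. For each of the q-1 other a, the solutions are b = i a and b = - i a if i^2
    = -1, and there are none if -1 is not a square; both counts equal 1 + [eta]. *)
Lemma num_sum2_sqr0 : (num_sum2_sqr 0)%:R = 1 + (#|F|%:R - 1) * (1 + eta).
Proof.
have fiber0 : #|[set b : F | 0 ^+ 2 + b ^+ 2 == 0]| = 1%N.
  apply: etrans (cards1 (0 : F)); apply: eq_card => b.
  by rewrite !inE expr0n /= add0r sqrf_eq0.
have fiberN0 (a : F) : a != 0 ->
    #|[set b : F | a ^+ 2 + b ^+ 2 == 0]|%:R = 1 + eta.
  move=> nza; rewrite -signr_odd; have [odd_half|even_half] := boolP (odd _).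
    rewrite expr1 subrr; apply/eqP; rewrite pnatr_eq0 cards_eq0.
    apply/eqP/setP=> b; rewrite !inE addrC addr_eq0; apply/negbTE.
    have := sqr_neqN1 (b / a) odd_half; apply: contraNneq => e.
    by rewrite expr_div_n e mulNr divff ?sqrf_eq0.
  have [i iN1] := exists_sqrtN1 even_half.
  rewrite expr0 (_ : [set b | _] = [set b | b ^+ 2 == (i * a) ^+ 2]).
    rewrite card_sqr_eq // mulf_neq0 //; apply: contra_eq_neq iN1 => ->.
    by rewrite expr0n eq_sym oppr_eq0 oner_eq0.
  by apply/setP=> b; rewrite !inE exprMn iN1 mulN1r addrC addr_eq0.
have -> : num_sum2_sqr 0 = (\sum_(a : F) #|[set b : F | (a ^+ 2 + b ^+ 2 == 0)%R]|)%N.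
  rewrite /num_sum2_sqr -sum1_card; under [RHS]eq_bigr do rewrite -sum1_card.
  by rewrite pair_big_dep /=; apply: eq_bigl => -[a b]; rewrite !inE.
rewrite (bigD1 0) //= fiber0 natrD natr_sum (eq_bigr _ fiberN0) sumr_const cardC1.
rewrite -[(_ + _) *+ _]mulr_natl -[#|F|.-1]subn1 natrB // ltnW //.
exact: finNzRing_gt1.
Qed.

Lemma num_sum2_sqr1 : (num_sum2_sqr 1)%:R = #|F|%:R - eta.
Proof.
(* All q^2 pairs are sorted by their value; the q-1 nonzero values are taken equally often. *)
have total : (num_sum2_sqr 0%R + #|F|.-1 * num_sum2_sqr 1%R = #|F| ^ 2)%N.
  rewrite -mulnn -card_prod -(sum1_card {: F * F}).
  rewrite (partition_big (fun u : F * F => u.1 ^+ 2 + u.2 ^+ 2) predT) //=.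
  under eq_bigr do rewrite sum1dep_card -/(num_sum2_sqr _).
  rewrite (bigD1 (0 : F)) //= (eq_bigr _ num_sum2_sqr_neq0).
  by rewrite sum_nat_const cardC1.
have nzq : #|F|%:R - 1 != 0 :> rat.
  by rewrite subr_eq0 pnatr_eq1 gtn_eqF ?finNzRing_gt1.
move/(congr1 (fun n => n%:R : rat)): total.
rewrite natrD natrM natrX num_sum2_sqr0 -subn1 natrB; last by rewrite ltnW ?finNzRing_gt1.
move=> total; apply: (mulfI nzq).
have -> : (#|F|%:R - 1) * (num_sum2_sqr 1)%:R =
   #|F|%:R ^+ 2 - (1 + (#|F|%:R - 1) * (1 + eta)) by rewrite -total; ring.
by ring.
Qed.

(** * Zeros of a sum of k squares *)

Definition num_sqr_zeros (k : nat) :=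
  #|[set x : {ffun 'I_k -> F} | \sum_i x i ^+ 2 == 0]|.

Lemma num_sqr_zerosSS (k : nat) :
  num_sqr_zeros k.+2 =
  (\sum_(y : {ffun 'I_k -> F}) num_sum2_sqr (- \sum_i y i ^+ 2)%R)%N.
Proof.
rewrite /num_sqr_zeros card_set_sum !sum_ffunS; apply: eq_bigr => y _.
rewrite /num_sum2_sqr card_set_sum pair_bigA /=; apply: eq_bigr => -[a b] _ /=.
by rewrite !sum_sqr_ffun_cons addrA addr_eq0 [b ^+ 2 + _]addrC.
Qed.

(** Each k-tuple that is itself a zero extends in [num_sum2_sqr 0] ways, and each of the others in
    [num_sum2_sqr 1] ways. *)
Lemma num_sqr_zeros_rec (k : nat) :
  (num_sqr_zeros k.+2)%:R =
  #|F|%:R ^+ k * (#|F|%:R - eta) + #|F|%:R * eta * (num_sqr_zeros k)%:R.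
Proof.
have zerosE : num_sqr_zeros k = #|[pred y : {ffun 'I_k -> F} | \sum_i y i ^+ 2 == 0]|.
  by rewrite /num_sqr_zeros cardsE.
have total : #|F|%:R ^+ k = (num_sqr_zeros k)%:R +
    #|[pred y : {ffun 'I_k -> F} | \sum_i y i ^+ 2 != 0]|%:R :> rat.
  rewrite -natrX -[k in LHS]card_ord -card_ffun -natrD zerosE.
  by rewrite -(cardC [pred y : {ffun 'I_k -> F} | \sum_i y i ^+ 2 == 0]).
rewrite num_sqr_zerosSS (bigID (fun y : {ffun 'I_k -> F} => \sum_i y i ^+ 2 == 0)) /=.
rewrite (eq_bigr (fun=> num_sum2_sqr 0)); last by move=> y /eqP ->; rewrite oppr0.
rewrite [X in (_ + X)%N](eq_bigr (fun=> num_sum2_sqr 1)); last first.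
  by move=> y nzy; rewrite num_sum2_sqr_neq0 // oppr_eq0.
rewrite !sum_nat_const -zerosE natrD !natrM num_sum2_sqr0 num_sum2_sqr1 total.
by ring.
Qed.

Lemma num_sqr_zeros_odd (m : nat) :
  (num_sqr_zeros m.*2.+1)%:R = #|F|%:R ^+ m.*2 :> rat.
Proof.
elim: m => [|m IHm].
  rewrite expr0 (_ : num_sqr_zeros 1 = 1%N) //.
  apply: etrans (cards1 [ffun=> 0 : F]); apply: eq_card => x; rewrite !inE big_ord1 sqrf_eq0.
  apply/eqP/eqP => [x0|->]; last by rewrite ffunE.
  by apply/ffunP=> i; rewrite ffunE ord1.
rewrite doubleS num_sqr_zeros_rec IHm !exprS; by ring.
Qed.

(** The quotients by q stand for q^(2m-1) and q^(m-1), so that the induction can start at m = 0,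
    where the value is 1/q + 1 - 1/q = 1. *)
Lemma num_sqr_zeros_even (m : nat) :
  (num_sqr_zeros m.*2)%:R =
  #|F|%:R ^+ m.*2 / #|F|%:R + eta ^+ m * (#|F|%:R ^+ m - #|F|%:R ^+ m / #|F|%:R) :> rat.
Proof.
have nzq : #|F|%:R != 0 :> rat by rewrite pnatr_eq0 -lt0n ltnW ?finNzRing_gt1.
elim: m => [|m IHm].
  rewrite (_ : num_sqr_zeros 0 = 1%N); first by rewrite !expr0; ring.
  rewrite /num_sqr_zeros (_ : [set x | _] = [set: _]) ?cardsT ?card_ffun ?card_ord //.
  by apply/setP=> x; rewrite !inE big_ord0 eqxx.
rewrite doubleS num_sqr_zeros_rec IHm !exprS; by field.
Qed.

End OddFiniteField.

(** * Values of [Phi] at primes, at prime powers and in general *)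

Lemma Phi_prime_Fp (k p : nat) :
  prime p -> Phi k p = #|[set x : {ffun 'I_k -> 'F_p} | \sum_i x i ^+ 2 != 0]|.
Proof.
(* ['F_p] is an ordinal type whose bound equals p only through [Fp_cast]; rewriting with it makes
   the two types of tuples coincide. *)
move=> p_pr; rewrite -{1}(Fp_cast p_pr) /Phi; apply: eq_card => x; rewrite !inE.
rewrite -/(coprime _ _) [X in coprime _ X]Fp_cast // coprime_sym prime_coprime //.
rewrite (dvdn_pcharf (pchar_Fp p_pr)) natr_sum; congr (_ != _).
by apply: eq_bigr => i _; rewrite natrX natr_Zp.
Qed.

(** Whatever the other entries, exactly one value of the first makes the sum odd. *)
Lemma Phi_prime2 (k : nat) : (0 < k)%N -> Phi k 2 = (2 ^ (k - 1))%N.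
Proof.
case: k => // k _; rewrite Phi_prime_Fp // card_set_sum sum_ffunS subn1 /=.
rewrite (eq_bigr (fun=> 1%N)) ?sum1_card ?card_ffun ?card_Fp ?card_ord // => y _.
under eq_bigr do rewrite sum_sqr_ffun_cons.
by move: (\sum_i y i ^+ 2) => s; rewrite !big_ord_recl big_ord0; case: s => [[|[|]]].
Qed.

(** The value 1 for odd k or p = 2 lets one product over all primes dividing n cover both cases of
    the theorem. *)
Definition Phi_factor (k p : nat) : rat :=
  if odd k || (p <= 2)%N then 1
  else 1 - (-1) ^+ ((k * (p - 1)) %/ 4) / p%:R ^+ (k %/ 2).

Lemma Phi_prime (k p : nat) : (0 < k)%N -> prime p ->
  (Phi k p)%:R = p%:R ^+ (k - 1) * (p - 1)%:R * Phi_factor k p.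
Proof.
move=> k_gt0 p_pr; rewrite /Phi_factor.
have [->|odd_p] := even_prime p_pr.
  by rewrite orbT Phi_prime2 // mulr1 mulr1 natrX.
have odd_Fp : odd #|'F_p| by rewrite card_Fp.
have -> : (p <= 2)%N = false by move: odd_p (prime_gt1 p_pr); lia.
rewrite orbF.
have -> : (Phi k p)%:R = p%:R ^+ k - (num_sqr_zeros 'F_p k)%:R :> rat.
  apply/eqP; rewrite eq_sym subr_eq -natrD -natrX eqr_nat; apply/eqP.
  have -> : (p ^ k)%N = #|{ffun 'I_k -> 'F_p}| by rewrite card_ffun card_Fp ?card_ord.
  rewrite Phi_prime_Fp // /num_sqr_zeros !cardsE addnC.
  by rewrite -(cardC [pred x : {ffun 'I_k -> 'F_p} | \sum_i x i ^+ 2 == 0]).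
have nzp : p%:R != 0 :> rat by rewrite pnatr_eq0 -lt0n prime_gt0.
rewrite natrB ?prime_gt0 //.
have [odd_k|even_k] := boolP (odd k).
  have [m ->] : exists m, k = m.*2.+1 by exists k./2; lia.
  by rewrite num_sqr_zeros_odd // card_Fp // subn1 /= exprS; ring.
have [m kE] : exists m, k = m.+1.*2 by exists k./2.-1; lia.
rewrite kE num_sqr_zeros_even // card_Fp // -exprM.
(* Both k and p - 1 are even, so the division by 4 is exact and the sign is [eta] to the power
   k/2. *)
have -> : ((m.+1.*2 * (p - 1)) %/ 4 = p./2 * m.+1)%N.
  by rewrite -[p in LHS](odd_double_half p) odd_p; nia.
have -> : (m.+1.*2 %/ 2 = m.+1)%N by lia.
have -> : (m.+1.*2 - 1 = m + m.+1)%N by lia.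
have -> : (m.+1.*2 = m.+1 + m.+1)%N by lia.
by rewrite !exprD !exprS; field; rewrite expf_neq0 ?nzp.
Qed.

Lemma Phi_prime_power (k p a : nat) : (0 < k)%N -> prime p -> (0 < a)%N ->
  (Phi k (p ^ a))%:R =
  (p ^ a)%:R ^+ (k - 1) * (totient (p ^ a))%:R * Phi_factor k p.
Proof.
case: k a => // k [//|a] _ p_pr _.
rewrite Phi_primeX // natrM Phi_prime // totient_pfactor // !subn1 /=.
rewrite !natrM !natrX !exprS exprMn; by ring.
Qed.

(** Strong induction on n: the full power of the least prime divisor is split off, leaving a smaller
    coprime cofactor. *)
Lemma Phi_totient (k n : nat) : (0 < k)%N -> (0 < n)%N ->
  (Phi k n)%:R =
  n%:R ^+ (k - 1) * (totient n)%:R * \prod_(p <- primes n) Phi_factor k p.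
Proof.
move=> k_gt0; elim/ltn_ind: n => n IHn n_gt0.
have [n_gt1|n_le1] := ltnP 1 n; last first.
  have -> : n = 1%N by lia.
  rewrite big_nil expr1n !mulr1 /Phi (_ : [set x | _] = [set: _]).
    by rewrite cardsT card_ffun !card_ord exp1n.
  by apply/setP=> x; rewrite !inE gcdn1.
have p_pr := pdiv_prime n_gt1; set p := pdiv n in p_pr.
have e_gt0 : (0 < logn p n)%N by rewrite logn_gt0 mem_primes p_pr n_gt0 pdiv_dvd.
have [m co_pm nE] := pfactor_coprime p_pr n_gt0; set e := logn p n in e_gt0 nE.
have m_gt0 : (0 < m)%N by move: n_gt0; rewrite nE; case: (m).
have pe_gt1 : (1 < p ^ e)%N by rewrite -(exp1n e) ltn_exp2r ?prime_gt1.
have co_mpe : coprime m (p ^ e) by rewrite coprime_sym coprimeXl.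
have lt_mn : (m < n)%N by rewrite nE ltn_Pmulr.
have primesE : perm_eq (primes n) (p :: primes m).
  apply: uniq_perm; rewrite ?primes_uniq //=.
    by rewrite primes_uniq andbT mem_primes p_pr m_gt0 -prime_coprime.
  by move=> r; rewrite nE primesM ?(ltnW pe_gt1) // primesX // (primes_prime p_pr) mem_seq1 in_cons orbC.
rewrite (perm_big _ primesE) big_cons /= nE Phi_coprimeM ?(ltnW pe_gt1) //.
rewrite totient_coprime // !natrM IHn // Phi_prime_power // exprMn; by ring.
Qed.

Theorem theorem1 (k : nat) (hk : (0 < k)%N) :
  (forall m n : nat, (0 < m)%N -> (0 < n)%N -> coprime m n ->
     Phi k (m * n) = (Phi k m * Phi k n)%N) /\
  (forall n : nat, (0 < n)%N ->
     (Phi k n)%:R =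
       (if odd k then
          n%:R ^+ (k - 1) * (totient n)%:R
        else
          n%:R ^+ (k - 1) * (totient n)%:R *
          \prod_(p <- primes n | (2 < p)%N)
             (1 - (-1) ^+ ((k * (p - 1)) %/ 4) / p%:R ^+ (k %/ 2)))
       :> rat).
Proof.
split=> [m n|n n_gt0]; first exact: Phi_coprimeM.
rewrite Phi_totient // /Phi_factor; case: (odd k) => /=; first by rewrite big1_eq mulr1.
by rewrite [in RHS]big_mkcond; congr (_ * _); apply: eq_bigr => p _; rewrite ltnNge; case: leqP.
Qed.
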